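(* Let $\mathcal J$ be the class of Novikov algebras over $F$ that have no irreducible right Novikov modules. Then $\mathcal J$ is a radical class in the class of all Novikov algebras over $F$.
   Context: $F$ is a field of characteristic different from $2$; all algebras are (not necessarily associative or unital) algebras over $F$. Write $(x,y,z)=(xy)z-x(yz)$. An algebra is a Novikov algebra if it satisfies the identities $(x,y,z)=(y,x,z)$ and $(xy)z=(xz)y$. Right modules. Let $\mathcal N_X$ be the free Novikov algebra over $F$ on countably many generators $X=\{x_1,x_2,\dots\}$. For a vector space $V$ let $T(V)$ be its tensor algebra; a linear map $\varphi:V\to B$ to a unital associative algebra $B$ induces the homomorphism $T(\varphi):T(V)\to B$, $1\mapsto 1$, $v_1\otimes\dots\otimes v_n\mapsto\varphi(v_1)\cdots\varphi(v_n)$. Endomorphisms act on the right: $m(\alpha\beta)=(m\alpha)\beta$. Let $R:\mathcal N_X\to\mathrm{End}(\mathcal N_X)$, $R(f)=R_f$, $gR_f=gf$. Elements of the kernel of $T(R):T(\mathcal N_X)\to\mathrm{End}(\mathcal N_X)$ are called R-identities. For $G(x_1,\dots,x_n)\in T(\mathcal N_X)$ and $a_1,\dots,a_n$ in a Novikov algebra $A$, $G(a_1,\dots,a_n)\in T(A)$ is obtained by substituting $a_i$ for $x_i$. A right (Novikov) representation of $A$ is a linear map $\rho:A\to\mathrm{End}(M)$, $M$ a vector space, such that $T(\rho)(G(a_1,\dots,a_n))=0$ for every R-identity $G$ and all $a_i\in A$. The space $M$ with the action $m\cdot a=m\rho(a)$ is then called a right (Novikov) $A$-module. A right $A$-module $M$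 is irreducible if it has no nonzero proper submodules and $MA\neq 0$. Radical classes. Let $\mathcal M$ be a class of algebras closed under homomorphic images and ideals (here: the class of Novikov algebras over $F$). For a subclass $\mathcal R\subseteq\mathcal M$, an $\mathcal R$-ideal of an algebra is a two-sided ideal which, as an algebra, belongs to $\mathcal R$. The subclass $\mathcal R$ is radical (in the Kurosh–Amitsur sense) if: (A) every homomorphic image of an algebra in $\mathcal R$ lies in $\mathcal R$; (B) every algebra $A$ in $\mathcal M$ has an $\mathcal R$-ideal $\mathcal R(A)$ containing all $\mathcal R$-ideals of $A$; (C) the algebra $A/\mathcal R(A)$ has no nonzero $\mathcal R$-ideals, for every $A$ in $\mathcal M$. *)

(* Defs.v *)
From HB Require Import structures.
From mathcomp Require Import all_boot all_algebra boolp.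

Set Implicit Arguments.
Unset Strict Implicit.
Unset Printing Implicit Defensive.

Import GRing.Theory.
Local Open Scope ring_scope.
Local Open Scope quotient_scope.

Reserved Notation "x ** y" (at level 40, left associativity).

HB.mixin Record Lmodule_isNaAlgebra (F : fieldType) A of GRing.Lmodule F A := {
  namul : A -> A -> A;
  namul_linear_l : forall y, linear (namul^~ y);
  namul_linear_r : forall x, linear (namul x)
}.

#[short(type="naAlgType")]
HB.structure Definition NaAlgebra (F : fieldType) :=
  {A of GRing.Lmodule F A & Lmodule_isNaAlgebra F A}.

Notation "x ** y" := (namul x y) : ring_scope.

Section NaAlgebraTheory.
Variables (F : fieldType) (A : naAlgType F).
Implicit Types (a : F) (x y z : A).

Lemma namulDl x y z : (x + y) ** z = x ** z + y ** z.
Proof. by have := namul_linear_l z 1 x y; rewrite !scale1r. Qed.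
Lemma namulDr x y z : x ** (y + z) = x ** y + x ** z.
Proof. by have := namul_linear_r x 1 y z; rewrite !scale1r. Qed.
Lemma namulBl x y z : (x - y) ** z = x ** z - y ** z.
Proof.
rewrite [x - y]addrC [RHS]addrC.
by have := namul_linear_l z (-1) y x; rewrite !scaleN1r.
Qed.
Lemma namulBr x y z : x ** (y - z) = x ** y - x ** z.
Proof.
rewrite [y - z]addrC [RHS]addrC.
by have := namul_linear_r x (-1) z y; rewrite !scaleN1r.
Qed.

End NaAlgebraTheory.

Definition associator (F : fieldType) (A : naAlgType F) (x y z : A) : A :=
  (x ** y) ** z - x ** (y ** z).

HB.mixin Record NaAlgebra_isNovikov (F : fieldType) A of NaAlgebra F A := {
  novikov_lsym : forall x y z : A, associator x y z = associator y x z;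
  novikov_rcomm : forall x y z : A, (x ** y) ** z = (x ** z) ** y
}.

#[short(type="novikovType")]
HB.structure Definition Novikov (F : fieldType) :=
  {A of NaAlgebra F A & NaAlgebra_isNovikov F A}.

Definition namul_morphism (F : fieldType) (A B : naAlgType F) (f : A -> B) :=
  {morph f : x y / x ** y}.

(* [algType] is not usable for End(M): it excludes the zero algebra End(0). *)

HB.mixin Record NaAlgebra_isUaAlgebra (F : fieldType) A of NaAlgebra F A := {
  ua_one : A;
  ua_mulA : forall x y z : A, x ** (y ** z) = (x ** y) ** z;
  ua_mul1 : forall x : A, ua_one ** x = x;
  ua_mulr1 : forall x : A, x ** ua_one = x
}.

#[short(type="uaAlgType")]
HB.structure Definition UaAlgebra (F : fieldType) :=
  {A of NaAlgebra F A & NaAlgebra_isUaAlgebra F A}.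

Section RightEnd.
Variables (F : fieldType) (M : lmodType F).

Definition rEnd : Type := {linear M -> M}.
Definition rEnd_fun (f : rEnd) : M -> M := (f : {linear M -> M}).
Coercion rEnd_fun : rEnd >-> Funclass.

Lemma rEndP (f g : rEnd) : (forall m, f m = g m) -> f = g.
Proof.
case: f g => [f cf] [g cg] /= /funext; rewrite /rEnd_fun /= => e.
case: _ / e cg => cg; congr GRing.Linear.Pack.
case: cf cg => [[a1] [b1]] [[a2] [b2]].
by rewrite (Prop_irrelevance a1 a2) (Prop_irrelevance b1 b2).
Qed.

Lemma rEnd_linear (f : rEnd) : linear f.
Proof. by move=> a x y; rewrite /rEnd_fun linearP. Qed.

HB.instance Definition _ (f : rEnd) := GRing.Linear.on (rEnd_fun f).

HB.instance Definition _ := gen_eqMixin rEnd.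
HB.instance Definition _ := gen_choiceMixin rEnd.

Definition rend_zero : rEnd := [the {linear M -> M} of \0 : M -> M].
Definition rend_opp (f : rEnd) : rEnd :=
  [the {linear M -> M} of (-%R : M -> M) \o (f : M -> M)].
Definition rend_add (f g : rEnd) : rEnd :=
  [the {linear M -> M} of (f : M -> M) \+ g].
Definition rend_scale (a : F) (f : rEnd) : rEnd :=
  [the {linear M -> M} of a \*: (f : M -> M)].
Definition rend_one : rEnd := [the {linear M -> M} of idfun : M -> M].
(* Endomorphisms act on the right, so [f ** g] applies [f] first. *)
Definition rend_mul (f g : rEnd) : rEnd :=
  [the {linear M -> M} of (g : M -> M) \o (f : M -> M)].

Fact rend_addA : associative rend_add.
Proof. by move=> f g h; apply: rEndP => m; apply: addrA. Qed.
Fact rend_addC : commutative rend_add.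
Proof. by move=> f g; apply: rEndP => m; apply: addrC. Qed.
Fact rend_add0 : left_id rend_zero rend_add.
Proof. by move=> f; apply: rEndP => m; apply: add0r. Qed.
Fact rend_addN : left_inverse rend_zero rend_opp rend_add.
Proof. by move=> f; apply: rEndP => m; apply: addNr. Qed.
HB.instance Definition _ :=
  GRing.isZmodule.Build rEnd rend_addA rend_addC rend_add0 rend_addN.

Fact rend_scaleA a b f :
  rend_scale a (rend_scale b f) = rend_scale (a * b) f.
Proof. by apply: rEndP => m; apply: scalerA. Qed.
Fact rend_scale1 : left_id 1 rend_scale.
Proof. by move=> f; apply: rEndP => m; apply: scale1r. Qed.
Fact rend_scaleDr : right_distributive rend_scale +%R.
Proof. by move=> a f g; apply: rEndP => m; apply: scalerDr. Qed.
Fact rend_scaleDl f : {morph rend_scale^~ f : a b / a + b}.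
Proof. by move=> a b; apply: rEndP => m; apply: scalerDl. Qed.
HB.instance Definition _ := GRing.Zmodule_isLmodule.Build F rEnd
  rend_scaleA rend_scale1 rend_scaleDr rend_scaleDl.

Fact rend_mul_linear_l g : linear (rend_mul^~ g).
Proof.
move=> a f f'; apply: rEndP => m; exact: (linearP (g : {linear M -> M})).
Qed.
Fact rend_mul_linear_r f : linear (rend_mul f).
Proof. by move=> a g g'; apply: rEndP. Qed.
HB.instance Definition _ := Lmodule_isNaAlgebra.Build F rEnd
  rend_mul_linear_l rend_mul_linear_r.

Fact rend_mulA (f g h : rEnd) : f ** (g ** h) = (f ** g) ** h.
Proof. by apply: rEndP. Qed.
Fact rend_mul1 (f : rEnd) : rend_one ** f = f.
Proof. by apply: rEndP. Qed.
Fact rend_mulr1 (f : rEnd) : f ** rend_one = f.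
Proof. by apply: rEndP. Qed.
HB.instance Definition _ := NaAlgebra_isUaAlgebra.Build F rEnd
  rend_mulA rend_mul1 rend_mulr1.

Lemma rEnd_mulE (f g : rEnd) m : (f ** g) m = g (f m). Proof. by []. Qed.
Lemma rEnd_addE (f g : rEnd) m : (f + g) m = f m + g m. Proof. by []. Qed.
Lemma rEnd_scaleE a (f : rEnd) m : (a *: f) m = a *: f m. Proof. by []. Qed.
Lemma rEnd_1E m : (ua_one : rEnd) m = m. Proof. by []. Qed.
Lemma rEnd_0E m : (0 : rEnd) m = 0. Proof. by []. Qed.

End RightEnd.

(* The tensor algebra T(V), presented as the unital associative algebra
   generated by V subject to the linearity of the inclusion V -> T(V);
   its universal property is [tens_ext_gen] and [tens_ext_unique]. *)

Section TensorAlgebra.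
Variables (F : fieldType) (V : lmodType F).

Inductive tterm : Type :=
  | TGen of V
  | TZero
  | TAdd of tterm & tterm
  | TScale of F & tterm
  | TOne
  | TMul of tterm & tterm.

Inductive tcongr : tterm -> tterm -> Prop :=
  | tc_refl s : tcongr s s
  | tc_sym s t : tcongr s t -> tcongr t s
  | tc_trans t s u : tcongr s t -> tcongr t u -> tcongr s u
  | tc_add s s' t t' :
      tcongr s s' -> tcongr t t' -> tcongr (TAdd s t) (TAdd s' t')
  | tc_scale a s s' : tcongr s s' -> tcongr (TScale a s) (TScale a s')
  | tc_mul s s' t t' :
      tcongr s s' -> tcongr t t' -> tcongr (TMul s t) (TMul s' t')
  | tc_addA s t u : tcongr (TAdd s (TAdd t u)) (TAdd (TAdd s t) u)
  | tc_addC s t : tcongr (TAdd s t) (TAdd t s)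
  | tc_add0 s : tcongr (TAdd TZero s) s
  | tc_addN s : tcongr (TAdd (TScale (-1) s) s) TZero
  | tc_scaleA a b s : tcongr (TScale a (TScale b s)) (TScale (a * b) s)
  | tc_scale1 s : tcongr (TScale 1 s) s
  | tc_scaleDr a s t :
      tcongr (TScale a (TAdd s t)) (TAdd (TScale a s) (TScale a t))
  | tc_scaleDl a b s :
      tcongr (TScale (a + b) s) (TAdd (TScale a s) (TScale b s))
  | tc_mulA s t u : tcongr (TMul s (TMul t u)) (TMul (TMul s t) u)
  | tc_mul1 s : tcongr (TMul TOne s) s
  | tc_mulr1 s : tcongr (TMul s TOne) s
  | tc_mulDl a s t u :
      tcongr (TMul (TAdd (TScale a s) t) u)
             (TAdd (TScale a (TMul s u)) (TMul t u))
  | tc_mulDr a s t u :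
      tcongr (TMul s (TAdd (TScale a t) u))
             (TAdd (TScale a (TMul s t)) (TMul s u))
  | tc_gen a v w :
      tcongr (TGen (a *: v + w)) (TAdd (TScale a (TGen v)) (TGen w)).

HB.instance Definition _ := gen_eqMixin tterm.
HB.instance Definition _ := gen_choiceMixin tterm.

Definition tcongrb : rel tterm := fun s t => `[< tcongr s t >].

Fact tcongrb_equiv : equiv_class_of tcongrb.
Proof.
split=> [s|s t|t s u]; first by apply/asboolP; apply: tc_refl.
  by apply/asboolP/asboolP; apply: tc_sym.
by move=> /asboolP st /asboolP tu; apply/asboolP; apply: tc_trans st tu.
Qed.
Canonical tcongrb_equiv_rel := EquivRelPack tcongrb_equiv.

Definition tensorAlg : Type := {eq_quot tcongrb}.
HB.instance Definition _ := Choice.on tensorAlg.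

Definition tpi (s : tterm) : tensorAlg := \pi_({eq_quot tcongrb}) s.
Definition trepr (x : tensorAlg) : tterm := repr (x : {eq_quot tcongrb}).

Lemma treprK x : tpi (trepr x) = x. Proof. exact: reprK. Qed.
Lemma tpiP s t : tpi s = tpi t <-> tcongr s t.
Proof.
split; first by move/eqmodP/asboolP.
by move=> st; apply/eqmodP/asboolP.
Qed.
Lemma trepr_pi s : tcongr (trepr (tpi s)) s.
Proof. by apply/tpiP; rewrite treprK. Qed.

Definition tens_zero := tpi TZero.
Definition tens_add x y := tpi (TAdd (trepr x) (trepr y)).
Definition tens_scale a x := tpi (TScale a (trepr x)).
Definition tens_opp := tens_scale (-1).
Definition tens_one := tpi TOne.
Definition tens_mul x y := tpi (TMul (trepr x) (trepr y)).
Definition tens_gen (v : V) : tensorAlg := tpi (TGen v).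

Fact tpi_add s t : tens_add (tpi s) (tpi t) = tpi (TAdd s t).
Proof. by apply/tpiP/tc_add; apply: trepr_pi. Qed.
Fact tpi_scale a s : tens_scale a (tpi s) = tpi (TScale a s).
Proof. by apply/tpiP/tc_scale; apply: trepr_pi. Qed.
Fact tpi_mul s t : tens_mul (tpi s) (tpi t) = tpi (TMul s t).
Proof. by apply/tpiP/tc_mul; apply: trepr_pi. Qed.

Let tE := (tpi_add, tpi_scale, tpi_mul).

Fact tens_addA : associative tens_add.
Proof.
move=> x y z; rewrite -[x]treprK -[y]treprK -[z]treprK !tE.
exact/tpiP/tc_addA.
Qed.
Fact tens_addC : commutative tens_add.
Proof.
by move=> x y; rewrite -[x]treprK -[y]treprK !tE; apply/tpiP/tc_addC.
Qed.
Fact tens_add0 : left_id tens_zero tens_add.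
Proof. by move=> x; rewrite -[x]treprK !tE; apply/tpiP/tc_add0. Qed.
Fact tens_addN : left_inverse tens_zero tens_opp tens_add.
Proof. by move=> x; rewrite -[x]treprK /tens_opp !tE; apply/tpiP/tc_addN. Qed.
HB.instance Definition _ :=
  GRing.isZmodule.Build tensorAlg tens_addA tens_addC tens_add0 tens_addN.

Fact tens_scaleA a b x :
  tens_scale a (tens_scale b x) = tens_scale (a * b) x.
Proof. by rewrite -[x]treprK !tE; apply/tpiP/tc_scaleA. Qed.
Fact tens_scale1 : left_id 1 tens_scale.
Proof. by move=> x; rewrite -[x]treprK !tE; apply/tpiP/tc_scale1. Qed.
Fact tens_scaleDr : right_distributive tens_scale +%R.
Proof.
move=> a x y; rewrite -[x]treprK -[y]treprK /GRing.add /= !tE.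
exact/tpiP/tc_scaleDr.
Qed.
Fact tens_scaleDl x : {morph tens_scale^~ x : a b / a + b}.
Proof.
move=> a b; rewrite -[x]treprK [RHS]/GRing.add /= !tE.
exact/tpiP/tc_scaleDl.
Qed.
HB.instance Definition _ := GRing.Zmodule_isLmodule.Build F tensorAlg
  tens_scaleA tens_scale1 tens_scaleDr tens_scaleDl.

Fact tens_mul_linear_l y : linear (tens_mul^~ y).
Proof.
move=> a u v; rewrite -[u]treprK -[v]treprK -[y]treprK.
by rewrite /GRing.scale /GRing.add /= !tE; apply/tpiP/tc_mulDl.
Qed.
Fact tens_mul_linear_r x : linear (tens_mul x).
Proof.
move=> a u v; rewrite -[u]treprK -[v]treprK -[x]treprK.
by rewrite /GRing.scale /GRing.add /= !tE; apply/tpiP/tc_mulDr.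
Qed.
HB.instance Definition _ := Lmodule_isNaAlgebra.Build F tensorAlg
  tens_mul_linear_l tens_mul_linear_r.

Fact tens_mulA (x y z : tensorAlg) : x ** (y ** z) = (x ** y) ** z.
Proof.
rewrite -[x]treprK -[y]treprK -[z]treprK /namul /= !tE.
exact/tpiP/tc_mulA.
Qed.
Fact tens_mul1 (x : tensorAlg) : tens_one ** x = x.
Proof. by rewrite -[x]treprK /namul /= !tE; apply/tpiP/tc_mul1. Qed.
Fact tens_mulr1 (x : tensorAlg) : x ** tens_one = x.
Proof. by rewrite -[x]treprK /namul /= !tE; apply/tpiP/tc_mulr1. Qed.
HB.instance Definition _ := NaAlgebra_isUaAlgebra.Build F tensorAlg
  tens_mulA tens_mul1 tens_mulr1.

Fact tens_gen_linear : linear tens_gen.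
Proof.
move=> a v w.
rewrite -[RHS]/(tens_add (tens_scale a (tens_gen v)) (tens_gen w)).
rewrite /tens_gen tpi_scale tpi_add.
exact/tpiP/tc_gen.
Qed.
HB.instance Definition _ :=
  GRing.isLinear.Build F V tensorAlg _ tens_gen tens_gen_linear.

Section Extension.
Variables (B : uaAlgType F) (phi : {linear V -> B}).

Fixpoint teval (s : tterm) : B :=
  match s with
  | TGen v => phi v
  | TZero => 0
  | TAdd s t => teval s + teval t
  | TScale a s => a *: teval s
  | TOne => ua_one
  | TMul s t => teval s ** teval t
  end.

Lemma teval_congr s t : tcongr s t -> teval s = teval t.
Proof.
elim=> {s t} //=; try by congruence.
- by move=> *; rewrite addrA.
- by move=> *; rewrite addrC.
- by move=> *; rewrite add0r.
- by move=> *; rewrite scaleN1r addNr.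
- by move=> *; rewrite scalerA.
- by move=> *; rewrite scale1r.
- by move=> *; rewrite scalerDr.
- by move=> *; rewrite scalerDl.
- by move=> s t u; apply: ua_mulA.
- by move=> s; apply: ua_mul1.
- by move=> s; apply: ua_mulr1.
- by move=> c s t u; apply: namul_linear_l.
- by move=> c s t u; apply: namul_linear_r.
- by move=> c v w; apply: linearP.
Qed.

(* The homomorphism T(phi) *)
Definition tens_ext (x : tensorAlg) : B := teval (trepr x).

Lemma tens_ext_pi s : tens_ext (tpi s) = teval s.
Proof. exact/teval_congr/trepr_pi. Qed.

Lemma tens_ext_gen v : tens_ext (tens_gen v) = phi v.
Proof. exact: tens_ext_pi. Qed.

Fact tens_ext_linear : linear tens_ext.
Proof.
move=> a x y; rewrite -[x]treprK -[y]treprK.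
by rewrite [in LHS]/GRing.scale [in LHS]/GRing.add /= !tE !tens_ext_pi.
Qed.

HB.instance Definition _ :=
  GRing.isLinear.Build F tensorAlg B _ tens_ext tens_ext_linear.

Lemma tens_ext1 : tens_ext ua_one = ua_one.
Proof. exact: tens_ext_pi. Qed.

Lemma tens_extM : namul_morphism tens_ext.
Proof.
move=> x y; rewrite -[x]treprK -[y]treprK.
by rewrite [in LHS]/namul /= !tE !tens_ext_pi.
Qed.

Lemma tens_ext_unique (g : tensorAlg -> B) : linear g ->
  g ua_one = ua_one -> namul_morphism g ->
  (forall v, g (tens_gen v) = phi v) -> g =1 tens_ext.
Proof.
move=> glin g1 gM gv x; rewrite -[x]treprK tens_ext_pi.
pose gl := GRing.isLinear.Build F tensorAlg B _ g glin.
pose g' : {linear tensorAlg -> B} := HB.pack g gl.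
elim: (trepr x) => [v||s IHs t IHt|a s IHs||s IHs t IHt] /=.
- exact: gv.
- exact: (linear0 g').
- by rewrite -tpi_add -IHs -IHt; apply: (linearD g').
- by rewrite -tpi_scale -IHs; apply: (linearZ_LR g').
- exact: g1.
- by rewrite -tpi_mul -IHs -IHt; apply: gM.
Qed.

End Extension.
End TensorAlgebra.

(* The free Novikov algebra N_X on X = {x_0, x_1, ...}: non-associative
   polynomials modulo the consequences of the Novikov identities; its universal
   property is [nov_ext_gen] and [nov_ext_unique]. *)

Section FreeNovikov.
Variable F : fieldType.

Inductive nterm : Type :=
  | NGen of nat
  | NZero
  | NAdd of nterm & nterm
  | NScale of F & nterm
  | NMul of nterm & nterm.

Definition NAssociator s t u :=
  NAdd (NMul (NMul s t) u) (NScale (-1) (NMul s (NMul t u))).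

Inductive ncongr : nterm -> nterm -> Prop :=
  | nc_refl s : ncongr s s
  | nc_sym s t : ncongr s t -> ncongr t s
  | nc_trans t s u : ncongr s t -> ncongr t u -> ncongr s u
  | nc_add s s' t t' :
      ncongr s s' -> ncongr t t' -> ncongr (NAdd s t) (NAdd s' t')
  | nc_scale a s s' : ncongr s s' -> ncongr (NScale a s) (NScale a s')
  | nc_mul s s' t t' :
      ncongr s s' -> ncongr t t' -> ncongr (NMul s t) (NMul s' t')
  | nc_addA s t u : ncongr (NAdd s (NAdd t u)) (NAdd (NAdd s t) u)
  | nc_addC s t : ncongr (NAdd s t) (NAdd t s)
  | nc_add0 s : ncongr (NAdd NZero s) s
  | nc_addN s : ncongr (NAdd (NScale (-1) s) s) NZero
  | nc_scaleA a b s : ncongr (NScale a (NScale b s)) (NScale (a * b) s)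
  | nc_scale1 s : ncongr (NScale 1 s) s
  | nc_scaleDr a s t :
      ncongr (NScale a (NAdd s t)) (NAdd (NScale a s) (NScale a t))
  | nc_scaleDl a b s :
      ncongr (NScale (a + b) s) (NAdd (NScale a s) (NScale b s))
  | nc_mulDl a s t u :
      ncongr (NMul (NAdd (NScale a s) t) u)
             (NAdd (NScale a (NMul s u)) (NMul t u))
  | nc_mulDr a s t u :
      ncongr (NMul s (NAdd (NScale a t) u))
             (NAdd (NScale a (NMul s t)) (NMul s u))
  | nc_lsym s t u : ncongr (NAssociator s t u) (NAssociator t s u)
  | nc_rcomm s t u : ncongr (NMul (NMul s t) u) (NMul (NMul s u) t).

HB.instance Definition _ := gen_eqMixin nterm.
HB.instance Definition _ := gen_choiceMixin nterm.

Definition ncongrb : rel nterm := fun s t => `[< ncongr s t >].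

Fact ncongrb_equiv : equiv_class_of ncongrb.
Proof.
split=> [s|s t|t s u]; first by apply/asboolP; apply: nc_refl.
  by apply/asboolP/asboolP; apply: nc_sym.
by move=> /asboolP st /asboolP tu; apply/asboolP; apply: nc_trans st tu.
Qed.
Canonical ncongrb_equiv_rel := EquivRelPack ncongrb_equiv.

Definition freeNov : Type := {eq_quot ncongrb}.
HB.instance Definition _ := Choice.on freeNov.

Definition npi (s : nterm) : freeNov := \pi_({eq_quot ncongrb}) s.
Definition nrepr (x : freeNov) : nterm := repr (x : {eq_quot ncongrb}).

Lemma nreprK x : npi (nrepr x) = x. Proof. exact: reprK. Qed.
Lemma npiP s t : npi s = npi t <-> ncongr s t.
Proof.
split; first by move/eqmodP/asboolP.
by move=> st; apply/eqmodP/asboolP.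
Qed.
Lemma nrepr_pi s : ncongr (nrepr (npi s)) s.
Proof. by apply/npiP; rewrite nreprK. Qed.

Definition fn_zero := npi NZero.
Definition fn_add x y := npi (NAdd (nrepr x) (nrepr y)).
Definition fn_scale a x := npi (NScale a (nrepr x)).
Definition fn_opp := fn_scale (-1).
Definition fn_mul x y := npi (NMul (nrepr x) (nrepr y)).
Definition fn_gen (i : nat) : freeNov := npi (NGen i).

Fact npi_add s t : fn_add (npi s) (npi t) = npi (NAdd s t).
Proof. by apply/npiP/nc_add; apply: nrepr_pi. Qed.
Fact npi_scale a s : fn_scale a (npi s) = npi (NScale a s).
Proof. by apply/npiP/nc_scale; apply: nrepr_pi. Qed.
Fact npi_mul s t : fn_mul (npi s) (npi t) = npi (NMul s t).
Proof. by apply/npiP/nc_mul; apply: nrepr_pi. Qed.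

Let nE := (npi_add, npi_scale, npi_mul).

Fact fn_addA : associative fn_add.
Proof.
move=> x y z; rewrite -[x]nreprK -[y]nreprK -[z]nreprK !nE.
exact/npiP/nc_addA.
Qed.
Fact fn_addC : commutative fn_add.
Proof.
by move=> x y; rewrite -[x]nreprK -[y]nreprK !nE; apply/npiP/nc_addC.
Qed.
Fact fn_add0 : left_id fn_zero fn_add.
Proof. by move=> x; rewrite -[x]nreprK !nE; apply/npiP/nc_add0. Qed.
Fact fn_addN : left_inverse fn_zero fn_opp fn_add.
Proof. by move=> x; rewrite -[x]nreprK /fn_opp !nE; apply/npiP/nc_addN. Qed.
HB.instance Definition _ :=
  GRing.isZmodule.Build freeNov fn_addA fn_addC fn_add0 fn_addN.

Fact fn_scaleA a b x : fn_scale a (fn_scale b x) = fn_scale (a * b) x.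
Proof. by rewrite -[x]nreprK !nE; apply/npiP/nc_scaleA. Qed.
Fact fn_scale1 : left_id 1 fn_scale.
Proof. by move=> x; rewrite -[x]nreprK !nE; apply/npiP/nc_scale1. Qed.
Fact fn_scaleDr : right_distributive fn_scale +%R.
Proof.
move=> a x y; rewrite -[x]nreprK -[y]nreprK /GRing.add /= !nE.
exact/npiP/nc_scaleDr.
Qed.
Fact fn_scaleDl x : {morph fn_scale^~ x : a b / a + b}.
Proof.
move=> a b; rewrite -[x]nreprK [RHS]/GRing.add /= !nE.
exact/npiP/nc_scaleDl.
Qed.
HB.instance Definition _ := GRing.Zmodule_isLmodule.Build F freeNov
  fn_scaleA fn_scale1 fn_scaleDr fn_scaleDl.

Fact fn_mul_linear_l y : linear (fn_mul^~ y).
Proof.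
move=> a u v; rewrite -[u]nreprK -[v]nreprK -[y]nreprK.
by rewrite /GRing.scale /GRing.add /= !nE; apply/npiP/nc_mulDl.
Qed.
Fact fn_mul_linear_r x : linear (fn_mul x).
Proof.
move=> a u v; rewrite -[u]nreprK -[v]nreprK -[x]nreprK.
by rewrite /GRing.scale /GRing.add /= !nE; apply/npiP/nc_mulDr.
Qed.
HB.instance Definition _ := Lmodule_isNaAlgebra.Build F freeNov
  fn_mul_linear_l fn_mul_linear_r.

Fact fn_lsym (x y z : freeNov) : associator x y z = associator y x z.
Proof.
rewrite /associator -[x]nreprK -[y]nreprK -[z]nreprK.
rewrite /namul /GRing.opp /GRing.add /= /fn_opp !nE.
exact/npiP/nc_lsym.
Qed.
Fact fn_rcomm (x y z : freeNov) : (x ** y) ** z = (x ** z) ** y.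
Proof.
rewrite -[x]nreprK -[y]nreprK -[z]nreprK /namul /= !nE.
exact/npiP/nc_rcomm.
Qed.
HB.instance Definition _ := NaAlgebra_isNovikov.Build F freeNov
  fn_lsym fn_rcomm.

Section Evaluation.
Variables (A : novikovType F) (a : nat -> A).

Fixpoint neval (s : nterm) : A :=
  match s with
  | NGen i => a i
  | NZero => 0
  | NAdd s t => neval s + neval t
  | NScale c s => c *: neval s
  | NMul s t => neval s ** neval t
  end.

Lemma neval_congr s t : ncongr s t -> neval s = neval t.
Proof.
elim=> {s t} //=; try by congruence.
- by move=> *; rewrite addrA.
- by move=> *; rewrite addrC.
- by move=> *; rewrite add0r.
- by move=> *; rewrite scaleN1r addNr.
- by move=> *; rewrite scalerA.
- by move=> *; rewrite scale1r.
- by move=> *; rewrite scalerDr.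
- by move=> *; rewrite scalerDl.
- by move=> c s t u; apply: namul_linear_l.
- by move=> c s t u; apply: namul_linear_r.
- by move=> s t u; rewrite !scaleN1r; apply: novikov_lsym.
- by move=> s t u; apply: novikov_rcomm.
Qed.

(* The homomorphism N_X -> A sending each generator x_i to a_i *)
Definition nov_ext (f : freeNov) : A := neval (nrepr f).

Lemma nov_ext_pi s : nov_ext (npi s) = neval s.
Proof. exact/neval_congr/nrepr_pi. Qed.

Lemma nov_ext_gen i : nov_ext (fn_gen i) = a i.
Proof. exact: nov_ext_pi. Qed.

Fact nov_ext_linear : linear nov_ext.
Proof.
move=> c x y; rewrite -[x]nreprK -[y]nreprK.
by rewrite [in LHS]/GRing.scale [in LHS]/GRing.add /= !nE !nov_ext_pi.
Qed.
HB.instance Definition _ :=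
  GRing.isLinear.Build F freeNov A _ nov_ext nov_ext_linear.

Lemma nov_ext_mul : namul_morphism nov_ext.
Proof.
move=> x y; rewrite -[x]nreprK -[y]nreprK.
by rewrite [in LHS]/namul /= !nE !nov_ext_pi.
Qed.

Lemma nov_ext_unique (g : freeNov -> A) : linear g -> namul_morphism g ->
  (forall i, g (fn_gen i) = a i) -> g =1 nov_ext.
Proof.
move=> glin gM gv x; rewrite -[x]nreprK nov_ext_pi.
pose gl := GRing.isLinear.Build F freeNov A _ g glin.
pose g' : {linear freeNov -> A} := HB.pack g gl.
elim: (nrepr x) => [v||s IHs t IHt|c s IHs|s IHs t IHt] /=.
- exact: gv.
- exact: (linear0 g').
- by rewrite -npi_add -IHs -IHt; apply: (linearD g').
- by rewrite -npi_scale -IHs; apply: (linearZ_LR g').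
- by rewrite -npi_mul -IHs -IHt; apply: gM.
Qed.

End Evaluation.
End FreeNovikov.

Section RightMultiplication.
Variables (F : fieldType) (A : naAlgType F).

Definition rmul_fun (f g : A) : A := g ** f.
HB.instance Definition _ f :=
  GRing.isLinear.Build F A A _ (rmul_fun f) (namul_linear_l f).

Definition rmul (f : A) : rEnd A := [the {linear A -> A} of rmul_fun f].

Fact rmul_linear : linear rmul.
Proof. by move=> a f g; apply: rEndP => m; apply: namul_linear_r. Qed.
HB.instance Definition _ :=
  GRing.isLinear.Build F A (rEnd A) _ rmul rmul_linear.
End RightMultiplication.

Section RightModules.
Variable F : fieldType.

Definition R_identity (G : tensorAlg (freeNov F)) : Prop :=
  tens_ext (@rmul F (freeNov F)) G = 0.

(* G(a_0, a_1, ...) in T(A).  As G involves finitely many generators only,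
   substituting a sequence is the same as substituting a finite tuple. *)
Definition tens_subst (A : novikovType F) (a : nat -> A)
    (G : tensorAlg (freeNov F)) : tensorAlg A :=
  tens_ext (tens_gen (V := A) \o nov_ext a) G.

Definition right_representation (A : novikovType F) (M : lmodType F)
    (rho : {linear A -> rEnd M}) : Prop :=
  forall G : tensorAlg (freeNov F), R_identity G ->
  forall a : nat -> A, tens_ext rho (tens_subst a G) = 0.

(* Submodules and ideals are boolean predicates; by the classical axioms of
   boolp every subset is of this form. *)
Definition submodule (A : novikovType F) (M : lmodType F)
    (rho : {linear A -> rEnd M}) (N : {pred M}) : Prop :=
  submod_closed N /\ {in N, forall m (a : A), rho a m \in N}.

Definition irreducible_module (A : novikovType F) (M : lmodType F)
    (rho : {linear A -> rEnd M}) : Prop :=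
  [/\ right_representation rho,
      forall N : {pred M}, submodule rho N -> N =i pred1 0 \/ N =i predT
    & exists m (a : A), rho a m != 0].

Definition no_irreducible_modules (A : novikovType F) : Prop :=
  ~ exists (M : lmodType F) (rho : {linear A -> rEnd M}),
      irreducible_module rho.

End RightModules.

HB.mixin Record isTwoSided (F : fieldType) (A : naAlgType F) (I : A -> bool) := {
  twoSided_l : forall x y, x \in I -> x ** y \in I;
  twoSided_r : forall x y, y \in I -> x ** y \in I
}.

#[short(type="naIdeal")]
HB.structure Definition NaIdeal (F : fieldType) (A : naAlgType F) :=
  {I of @GRing.SubmodClosed F A I & isTwoSided F A I}.

Fact naIdeal_oppr (F : fieldType) (A : naAlgType F) (I : naIdeal A) :
  oppr_closed (I : {pred A}).
Proof. by move=> x Ix; rewrite -scaleN1r rpredZ. Qed.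
HB.instance Definition _ (F : fieldType) (A : naAlgType F) (I : naIdeal A) :=
  GRing.isOppClosed.Build A (NaIdeal.sort I) (@naIdeal_oppr F A I).

Section IdealAlgebra.
Variables (F : fieldType) (A : naAlgType F) (I : naIdeal A).

Record idealAlg : Type := IdealAlg { ideal_val : A; _ : ideal_val \in I }.
HB.instance Definition _ := [isSub for ideal_val].
HB.instance Definition _ := [Choice of idealAlg by <:].
HB.instance Definition _ := [SubChoice_isSubLmodule of idealAlg by <:].

Fact ideal_mul_subproof (x y : idealAlg) : val x ** val y \in I.
Proof. exact/twoSided_l/valP. Qed.
Definition ideal_mul (x y : idealAlg) : idealAlg :=
  IdealAlg (ideal_mul_subproof x y).

Fact ideal_mul_linear_l y : linear (ideal_mul^~ y).
Proof. by move=> a u v; apply: val_inj; apply: namul_linear_l. Qed.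
Fact ideal_mul_linear_r x : linear (ideal_mul x).
Proof. by move=> a u v; apply: val_inj; apply: namul_linear_r. Qed.
HB.instance Definition _ := Lmodule_isNaAlgebra.Build F idealAlg
  ideal_mul_linear_l ideal_mul_linear_r.

End IdealAlgebra.

Section NovikovIdeal.
Variables (F : fieldType) (A : novikovType F) (I : naIdeal A).
Fact ideal_lsym (x y z : idealAlg I) : associator x y z = associator y x z.
Proof. by apply: val_inj; apply: novikov_lsym. Qed.
Fact ideal_rcomm (x y z : idealAlg I) : (x ** y) ** z = (x ** z) ** y.
Proof. by apply: val_inj; apply: novikov_rcomm. Qed.
HB.instance Definition _ := NaAlgebra_isNovikov.Build F (idealAlg I)
  ideal_lsym ideal_rcomm.
End NovikovIdeal.

Section QuotientAlgebra.
Variables (F : fieldType) (A : naAlgType F) (I : naIdeal A).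

Definition quotAlg : Type := Quotient.quot I.
HB.instance Definition _ := GRing.Zmodule.on quotAlg.

Definition quot_pi (x : A) : quotAlg := \pi_(Quotient.quot I) x.
Definition quot_repr (x : quotAlg) : A := repr (x : Quotient.quot I).

Lemma quot_reprK x : quot_pi (quot_repr x) = x. Proof. exact: reprK. Qed.
Lemma quot_piP x y : quot_pi x = quot_pi y <-> x - y \in I.
Proof. by rewrite (Quotient.idealrBE I); split=> [/eqP|/eqP]. Qed.
Lemma quot_repr_pi x : quot_repr (quot_pi x) - x \in I.
Proof. by apply/quot_piP; rewrite quot_reprK. Qed.

Definition quot_scale a x := quot_pi (a *: quot_repr x).
Definition quot_mul x y := quot_pi (quot_repr x ** quot_repr y).

Fact quot_pi_add x y : quot_pi x + quot_pi y = quot_pi (x + y).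
Proof. exact/esym/(raddfD (\pi_(Quotient.quot I))). Qed.
Fact quot_pi_opp x : - quot_pi x = quot_pi (- x).
Proof. exact/esym/(raddfN (\pi_(Quotient.quot I))). Qed.
Fact quot_pi_scale a x : quot_scale a (quot_pi x) = quot_pi (a *: x).
Proof. by apply/quot_piP; rewrite -scalerBr rpredZ // quot_repr_pi. Qed.
Fact quot_pi_mul x y : quot_mul (quot_pi x) (quot_pi y) = quot_pi (x ** y).
Proof.
apply/quot_piP; set u := quot_repr _; set v := quot_repr _.
have -> : u ** v - x ** y = (u - x) ** v + x ** (v - y).
  by rewrite namulBl namulBr addrA subrK.
by apply: rpredD; [apply: twoSided_l | apply: twoSided_r]; apply: quot_repr_pi.
Qed.

Let qE := (quot_pi_scale, quot_pi_mul, quot_pi_add, quot_pi_opp).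

Fact quot_scaleA a b x : quot_scale a (quot_scale b x) = quot_scale (a * b) x.
Proof. by rewrite -[x]quot_reprK !qE scalerA. Qed.
Fact quot_scale1 : left_id 1 quot_scale.
Proof. by move=> x; rewrite -[x]quot_reprK !qE scale1r. Qed.
Fact quot_scaleDr : right_distributive quot_scale +%R.
Proof.
by move=> a x y; rewrite -[x]quot_reprK -[y]quot_reprK !qE scalerDr.
Qed.
Fact quot_scaleDl x : {morph quot_scale^~ x : a b / a + b}.
Proof. by move=> a b; rewrite -[x]quot_reprK !qE scalerDl. Qed.
HB.instance Definition _ := GRing.Zmodule_isLmodule.Build F quotAlg
  quot_scaleA quot_scale1 quot_scaleDr quot_scaleDl.

Fact quot_pi_linear : linear quot_pi.
Proof.
by move=> a x y; rewrite -[RHS]/(quot_scale a (quot_pi x) + quot_pi y) !qE.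
Qed.
HB.instance Definition _ :=
  GRing.isLinear.Build F A quotAlg _ quot_pi quot_pi_linear.

Fact quot_mul_linear_l y : linear (quot_mul^~ y).
Proof.
move=> a u v; rewrite -[u]quot_reprK -[v]quot_reprK -[y]quot_reprK.
rewrite -quot_pi_linear /= !quot_pi_mul -quot_pi_linear.
by congr quot_pi; apply: namul_linear_l.
Qed.
Fact quot_mul_linear_r x : linear (quot_mul x).
Proof.
move=> a u v; rewrite -[u]quot_reprK -[v]quot_reprK -[x]quot_reprK.
rewrite -quot_pi_linear /= !quot_pi_mul -quot_pi_linear.
by congr quot_pi; apply: namul_linear_r.
Qed.
HB.instance Definition _ := Lmodule_isNaAlgebra.Build F quotAlg
  quot_mul_linear_l quot_mul_linear_r.

Lemma quot_piM : namul_morphism quot_pi.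
Proof. by move=> x y; rewrite -quot_pi_mul. Qed.

End QuotientAlgebra.

Section NovikovQuotient.
Variables (F : fieldType) (A : novikovType F) (I : naIdeal A).
Fact quot_lsym (x y z : quotAlg I) : associator x y z = associator y x z.
Proof.
rewrite /associator -[x]quot_reprK -[y]quot_reprK -[z]quot_reprK.
by rewrite -!quot_piM -!linearB /= -/(associator _ _ _) novikov_lsym.
Qed.
Fact quot_rcomm (x y z : quotAlg I) : (x ** y) ** z = (x ** z) ** y.
Proof.
rewrite -[x]quot_reprK -[y]quot_reprK -[z]quot_reprK.
by rewrite -!quot_piM novikov_rcomm.
Qed.
HB.instance Definition _ := NaAlgebra_isNovikov.Build F (quotAlg I)
  quot_lsym quot_rcomm.
End NovikovQuotient.

Section RadicalClasses.
Variables (F : fieldType) (R : novikovType F -> Prop).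

Definition class_ideal (A : novikovType F) (I : naIdeal A) : Prop :=
  R (idealAlg I).

Definition radical_ideal (A : novikovType F) (I : naIdeal A) : Prop :=
  class_ideal I /\ forall J : naIdeal A, class_ideal J -> {subset J <= I}.

Definition radical_class : Prop :=
  [/\ forall (A B : novikovType F) (f : {linear A -> B}),
        namul_morphism f -> (forall y, exists x, f x = y) -> R A -> R B,
      forall A : novikovType F, exists I : naIdeal A, radical_ideal I
    & forall (A : novikovType F) (I : naIdeal A), radical_ideal I ->
      forall J : naIdeal (quotAlg I), class_ideal J -> J =i pred1 0].

End RadicalClasses.

(* Main.v *)
Require Import Defs.
From mathcomp Require Import all_boot all_algebra.
From mathcomp Require Import boolp.
From HB Require Import structures.
Import GRing.Theory.
Local Open Scope ring_scope.

(** For a right representation [rho] put [d x y := rho (x ** y) - rho x ** rho y].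
    In the differential model [x ** y = x y'], where [rho x] is multiplication
    by [x'], [d x y] is multiplication by [x y'']; hence the R-identities
    [[rho x, rho y] = 0], [d (x ** a) y = d x y ** rho a] and
    [d x y ** d z w = d z y ** d x w].
    They imply that an irreducible [A]-module [M] stays irreducible over every
    ideal [I] that does not annihilate it: for [0 != n] in [M], one of the spaces
    [n d I y] (with [y] in [I] such that [d] is nonzero on [I] and [y]) and
    [n rho I] (if [d] vanishes on [I], hence on [I x A] or on [A x I]) is a
    nonzero [A]-submodule of [M], contained in every [I]-submodule containing [n].
    So an irreducible module of the sum of all ideals without irreducible
    modules would be annihilated by each of them, and an irreducible module of
    an extension of such algebras would be a module over the quotient. *)

Set Implicit Arguments.
Unset Strict Implicit.
Unset Printing Implicit Defensive.

(** * Naturality of substitution and of the induced homomorphisms *)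

Section Substitution.
Variable F : fieldType.

Lemma eq_tens_ext (V : lmodType F) (B : uaAlgType F)
    (phi psi : {linear V -> B}) : phi =1 psi -> tens_ext phi =1 tens_ext psi.
Proof.
move=> eq_phi; apply: tens_ext_unique.
- exact: tens_ext_linear.
- exact: tens_ext1.
- exact: tens_extM.
- by move=> v; rewrite tens_ext_gen.
Qed.

(** Both sides are homomorphisms of [T(N_X)] that agree on generators. *)
Lemma tens_ext_subst (A : novikovType F) (B : uaAlgType F)
    (rho : {linear A -> B}) (a : nat -> A) (G : tensorAlg (freeNov F)) :
  tens_ext rho (tens_subst a G) = tens_ext (rho \o nov_ext a) G.
Proof.
rewrite /tens_subst.
apply: (@tens_ext_unique _ _ _ _ (fun G => tens_ext rho (tens_ext _ G))).
- by move=> c x y; rewrite !linearP.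
- by rewrite !tens_ext1.
- by move=> x y; rewrite !tens_extM.
- by move=> v; rewrite !tens_ext_gen.
Qed.

Lemma nov_ext_comp (A B : novikovType F) (f : {linear A -> B})
    (a : nat -> A) : namul_morphism f -> f \o nov_ext a =1 nov_ext (f \o a).
Proof.
move=> fM; apply: nov_ext_unique.
- by move=> c x y /=; rewrite !linearP.
- by move=> x y /=; rewrite nov_ext_mul fM.
- by move=> i /=; rewrite nov_ext_gen.
Qed.

Lemma tens_subst_comp (A B : novikovType F) (M : lmodType F)
    (f : {linear A -> B}) (rho : {linear B -> rEnd M}) a G :
  namul_morphism f ->
  tens_ext (rho \o f) (tens_subst a G) = tens_ext rho (tens_subst (f \o a) G).
Proof.
move=> fM; rewrite !tens_ext_subst; apply: eq_tens_ext => v /=.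
by congr (rho _); apply: nov_ext_comp.
Qed.

End Substitution.

(** * Associator identities in Novikov algebras *)

Section NovikovIdentities.
Variables (F : fieldType) (A : novikovType F).
Implicit Types g x y z w : A.

Lemma namulNl x y : (- x) ** y = - (x ** y).
Proof. exact: (linearN (rmul y)). Qed.

Lemma associatorNl x y z : associator (- x) y z = - associator x y z.
Proof. by rewrite /associator !namulNl opprB opprK addrC. Qed.

(** Right commutativity moves [a] to the far right in both terms. *)
Lemma associatorMl x a y z :
  associator (x ** a) y z = associator x y z ** a.
Proof.
rewrite /associator namulBl (novikov_rcomm x a y).
by rewrite (novikov_rcomm (x ** y) a) (novikov_rcomm x a).
Qed.

Lemma associatorMm x y a z :
  associator x (y ** a) z = associator x y z ** a.
Proof. by rewrite novikov_lsym associatorMl novikov_lsym. Qed.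

Lemma associatorBl x x' y z :
  associator (x - x') y z = associator x y z - associator x' y z.
Proof. by rewrite /associator !namulBl !opprD !opprK addrACA. Qed.

(** By [associatorMl], taking [g] to [associator g z w] commutes with right multiplications, from
    which [associator g x y] is built. *)
Lemma associatorC g x y z w :
  associator (associator g x y) z w = associator (associator g z w) x y.
Proof. by rewrite [associator g x y]/associator associatorBl !associatorMl. Qed.

(* Both the exchange of [g] with [x] and the simultaneous exchange of [x], [y]
   with [z], [w] are symmetries of the left side; they generate this one. *)
Lemma associator_swap g x y z w :
  associator (associator g x y) z w = associator (associator g z y) x w.
Proof.
rewrite (novikov_lsym g) (associatorC x g).
rewrite (novikov_lsym x) (associatorC z x).
by rewrite (novikov_lsym z).
Qed.

End NovikovIdentities.

(** * Deviation of a map from multiplicativity *)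

Section Defect.
Variable F : fieldType.

(** With [tens_gen] for [rho] this is an element of the tensor algebra, usable in R-identities. *)
Definition defect (A : naAlgType F) (B : uaAlgType F) (rho : A -> B)
  (x y : A) : B := rho (x ** y) - rho x ** rho y.

Lemma tens_ext_defect (A : naAlgType F) (B : uaAlgType F)
    (rho : {linear A -> B}) x y :
  tens_ext rho (defect (@tens_gen F A) x y) = defect rho x y.
Proof. by rewrite /defect linearB /= tens_extM !tens_ext_gen. Qed.

Lemma defect_comp (A A' : naAlgType F) (B : uaAlgType F) (f : A -> A')
    (rho : A' -> B) x y : namul_morphism f ->
  defect (rho \o f) x y = defect rho (f x) (f y).
Proof. by move=> fM; rewrite /defect /= fM. Qed.

(** Translates associator identities into R-identities. *)
Lemma defect_rmul (A : naAlgType F) (x y m : A) :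
  (defect (@rmul F A) x y : rEnd A) m = - associator m x y.
Proof. by rewrite /associator opprB. Qed.

Lemma defect_linear_l (A : naAlgType F) (M : lmodType F)
  (rho : {linear A -> rEnd M}) y m : linear (fun x => defect rho x y m).
Proof.
move=> a x x'; rewrite /defect namul_linear_l !linearP namul_linear_l.
apply: etrans (_ : (a *: defect rho x y + defect rho x' y) m = _) => //.
by congr (_ m : M); rewrite /defect scalerBr opprD addrACA.
Qed.

End Defect.

(** * R-identities evaluated in a right representation *)

Section RightRepresentation.
Variables (F : fieldType) (A : novikovType F) (M : lmodType F).
Variable rho : {linear A -> rEnd M}.
Hypothesis rho_rep : right_representation rho.
Implicit Types a b x y z w : A.

(** Generators beyond the length of [s] go to 0; the identities below do not contain them. *)
Let rho_id (G : tensorAlg (freeNov F)) (s : seq A) :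
  R_identity G -> tens_ext (rho \o nov_ext (nth 0 s)) G = 0.
Proof. by move=> G0; rewrite -tens_ext_subst; apply: rho_rep. Qed.

Let X i := fn_gen F i.

Lemma rep_comm x y : rho x ** rho y = rho y ** rho x.
Proof.
pose G := tens_gen (X 0) ** tens_gen (X 1) - tens_gen (X 1) ** tens_gen (X 0).
have G0 : R_identity G.
  rewrite /R_identity linearB /= !tens_extM !tens_ext_gen.
  by apply: rEndP => m; apply/eqP; rewrite subr_eq0; apply/eqP/novikov_rcomm.
have := rho_id [:: x; y] G0.
rewrite linearB /= !tens_extM !tens_ext_gen /= !nov_ext_gen /=.
exact: subr0_eq.
Qed.

Lemma rep_defectM x a y : defect rho (x ** a) y = defect rho x y ** rho a.
Proof.
pose G := defect (@tens_gen F _) (X 0 ** X 1) (X 2) -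
          defect (@tens_gen F _) (X 0) (X 2) ** tens_gen (X 1).
have G0 : R_identity G.
  rewrite /R_identity linearB /= tens_extM !tens_ext_defect tens_ext_gen.
  apply/eqP; rewrite subr_eq0; apply/eqP.
  apply: rEndP => m; rewrite rEnd_mulE !defect_rmul associatorMm.
  by rewrite -[RHS]/(_ ** _) namulNl.
have := rho_id [:: x; a; y] G0.
rewrite linearB /= tens_extM !tens_ext_defect tens_ext_gen /=.
rewrite !(defect_comp _ _ _ (nov_ext_mul _)) nov_ext_mul !nov_ext_gen /=.
exact: subr0_eq.
Qed.

(** For right multiplications this is [associator_swap]: the two signs cancel. *)
Lemma rep_defect_swap x y z w :
  defect rho x y ** defect rho z w = defect rho z y ** defect rho x w.
Proof.
pose d i j := defect (@tens_gen F _) (X i) (X j).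
have G0 : R_identity (d 0%N 1%N ** d 2%N 3%N - d 2%N 1%N ** d 0%N 3%N).
  rewrite /R_identity linearB /= !tens_extM !tens_ext_defect.
  apply/eqP; rewrite subr_eq0; apply/eqP.
  apply: rEndP => m; rewrite !rEnd_mulE !defect_rmul.
  by rewrite !associatorNl associator_swap.
have := rho_id [:: x; y; z; w] G0.
rewrite linearB /= !tens_extM !tens_ext_defect /=.
rewrite !(defect_comp _ _ _ (nov_ext_mul _)) !nov_ext_gen /=.
exact: subr0_eq.
Qed.

End RightRepresentation.

(** * Irreducible modules and their restriction to ideals *)

Section IrreducibleModule.
Variables (F : fieldType) (A : novikovType F) (M : lmodType F).
Variable rho : {linear A -> rEnd M}.
Hypothesis rho_irr : irreducible_module rho.

Let rho_rep : right_representation rho. Proof. by case: rho_irr. Qed.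

(** The range of [g] is a nonzero submodule. *)
Lemma irreducible_image (B : lmodType F) (g : B -> M) : linear g ->
  (forall z a, exists z', rho a (g z) = g z') -> (exists z, g z != 0) ->
  forall m, exists z, m = g z.
Proof.
move=> glin gA [z0 gz0]; case: rho_irr => _ simple _.
pose gl := GRing.isLinear.Build F B M _ g glin.
pose g' : {linear B -> M} := HB.pack g gl.
pose N : {pred M} := [pred m | `[< exists z, m = g z >]].
have subN : submodule rho N.
  split; first split.
  - by apply/asboolP; exists 0; rewrite -[g]/(g' : _ -> _) linear0.
  - move=> c _ _ /asboolP[z ->] /asboolP[z' ->]; apply/asboolP.
    by exists (c *: z + z'); rewrite glin.
  - move=> _ /asboolP[z ->] a; apply/asboolP.
    by have [z' ->] := gA z a; exists z'.
have [N0|NT] := simple _ subN => m.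
  have : g z0 \in N by apply/asboolP; exists z0.
  by rewrite N0 inE (negPf gz0).
by apply/asboolP; rewrite -[asbool _]/(m \in N) NT.
Qed.

(** Half of Schur's lemma: the kernel of [T] is a proper submodule. *)
Lemma irreducible_comm_inj (T : rEnd M) :
  (forall a, rho a ** T = T ** rho a) -> T != 0 ->
  forall m, m != 0 -> T m != 0.
Proof.
move=> Tcomm T0 m m0; apply: contra_neqN m0 => /eqP Tm0.
case: rho_irr => _ simple _.
pose N : {pred M} := [pred m | T m == 0].
have subN : submodule rho N.
  split; first split.
  - by rewrite inE linear0.
  - move=> c x y; rewrite !inE => /eqP Tx /eqP Ty.
    by rewrite linearP /= Tx Ty scaler0 addr0.
  - move=> x; rewrite !inE => /eqP Tx a.
    by rewrite inE -rEnd_mulE Tcomm rEnd_mulE Tx linear0.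
have mN : m \in N by rewrite inE Tm0.
have [N0|NT] := simple _ subN; first by apply/eqP; rewrite N0 in mN.
case/eqP: T0; apply: rEndP => x; apply/eqP.
by rewrite -[_ == _]/(x \in N) NT.
Qed.

Lemma defect_comm x y a :
  rho a ** defect rho x y = defect rho x y ** rho a.
Proof.
by rewrite /defect namulBr namulBl ua_mulA !(rep_comm rho_rep a)
  -!ua_mulA (rep_comm rho_rep a).
Qed.

Variables (B : novikovType F) (f : {linear B -> A}).
Hypothesis fM : namul_morphism f.
Hypothesis f_ideal :
  forall b a, (exists b', f b' = f b ** a) /\ (exists b', f b' = a ** f b).

(* Nonzero defects commute with [rho], so they act injectively, whereas
   [d (f x) a ** d b (f y) = d b a ** d (f x) (f y) = 0]. *)
Lemma defect_ideal0 :
  (forall x y, defect rho (f x) (f y) = 0) ->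
  (forall x a, defect rho (f x) a = 0) \/ (forall x a, defect rho a (f x) = 0).
Proof.
move=> d0; apply: contrapT => /not_orP[].
move=> /existsNP[x /existsNP[a /eqP dxa]] /existsNP[y /existsNP[b /eqP dby]].
have [_ _ [m [c cm]]] := rho_irr.
have m0 : m != 0 by apply: contraNneq cm => ->; rewrite linear0.
have inj z w := irreducible_comm_inj (@defect_comm z w).
have := inj _ _ dby _ (inj _ _ dxa _ m0).
by rewrite -rEnd_mulE (rep_defect_swap rho_rep) d0 rEnd_mulE eqxx.
Qed.

(** A general [f] whose image is an ideal covers both ideal inclusions and surjections. *)
Lemma irreducible_comp :
  (exists m b, rho (f b) m != 0) -> irreducible_module (rho \o f).
Proof.
move=> [m0 [b0 fb0]]; split.
- by move=> G G0 b; rewrite tens_subst_comp //; apply: rho_rep.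
- move=> N [Nlin Nsub].
  have [[n [nN n0]]|N0] := pselect (exists n, n \in N /\ n != 0); last first.
    left=> m; rewrite inE; apply/idP/eqP => [mN|->]; last exact: Nlin.1.
    by apply: contrapT => /eqP m0'; apply: N0; exists m.
  right=> m; rewrite [RHS]inE.
  suff [g [glin gA g0 gN]] : exists g : B -> M,
      [/\ linear g, forall z a, exists z', rho a (g z) = g z',
        exists z, g z != 0 & forall z, g z \in N].
    by have [z ->] := irreducible_image glin gA g0 m; apply: gN.
  have [[x [y dxy]]|nd] :=
      pselect (exists x y, defect rho (f x) (f y) != 0).
    exists (fun z => defect rho (f z) (f y) n); split.
    + by move=> c z z'; rewrite linearP defect_linear_l.
    + move=> z a; have [[z' fz'] _] := f_ideal z a.
      by exists z'; rewrite fz' (rep_defectM rho_rep).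
    + exists x; exact: irreducible_comm_inj (defect_comm _ _) dxy _ n0.
    (* This defect involves only the action of the image of [f], which preserves [N]. *)
    + move=> z; rewrite /defect -fM.
      apply: (GRing.linear_closedB Nlin.2); first exact: Nsub.
      by rewrite rEnd_mulE; do 2! apply: (Nsub).
  have d0 x y : defect rho (f x) (f y) = 0.
    by apply: contrapT => /eqP dxy; apply: nd; exists x, y.
  exists (fun z => rho (f z) n); split.
  + by move=> c z z'; rewrite !linearP.
  (* Either vanishing makes [rho (f z) ** rho a] the action of a product in the image of [f]; the
     second also uses commutativity. *)
  + have [d0l|d0r] := defect_ideal0 d0.
    * move=> z a; have [[z' fz'] _] := f_ideal z a; exists z'.
      by rewrite fz' (subr0_eq (d0l z a)).
    * move=> z a; have [_ [z' fz']] := f_ideal z a; exists z'.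
      by rewrite fz' (subr0_eq (d0r z a)) -(rep_comm rho_rep).
  + exists b0; apply: irreducible_comm_inj n0.
      by move=> a; apply: rep_comm.
    by apply: contraNneq fb0 => ->.
  + by move=> z; apply: Nsub.
- by exists m0, b0.
Qed.

End IrreducibleModule.

(** * Descent of irreducible modules along surjections *)

Lemma irreducible_factor (F : fieldType) (A B : novikovType F)
    (g : {linear A -> B}) (M : lmodType F) (rho : {linear A -> rEnd M}) :
  namul_morphism g -> (forall b, exists a, g a = b) ->
  (forall a, g a = 0 -> rho a = 0) -> irreducible_module rho ->
  exists rho' : {linear B -> rEnd M}, irreducible_module rho'.
Proof.
move=> gM gsurj kerg [rep simple [m [a0 am0]]].
(* [s] is only a set-theoretic section; [rho \o s] is linear because [rho] vanishes on the kernel of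
   [g]. *)
have [s sK] := choice gsurj.
have sg a : rho (s (g a)) = rho a.
  by apply: subr0_eq; rewrite -linearB kerg // linearB /= sK subrr.
have rho'lin : linear (rho \o s).
  move=> c x y /=; rewrite -linearP -[RHS]sg.
  by rewrite linearP /= !sK.
pose rl := GRing.isLinear.Build F B (rEnd M) _ _ rho'lin.
pose rho' : {linear B -> rEnd M} := HB.pack (rho \o s) rl.
have rho'g : (rho' \o g) =1 rho := sg.
exists rho'; split.
- move=> G G0 b.
  (* Lifting the substitution to [A] reduces the claim to [rho]. *)
  have -> : b = g \o (s \o b) by apply: funext => i /=; rewrite sK.
  rewrite -tens_subst_comp // (eq_tens_ext rho'g); exact: rep.
- move=> N [Nlin Nsub]; apply: simple; split=> // n nN a.
  by rewrite -rho'g; apply: Nsub.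
- by exists m, (g a0); rewrite -[rho' _]/((rho' \o g) a0) rho'g.
Qed.

(** * Sums of families of ideals *)

Section IdealSum.
Variables (F : fieldType) (A : naAlgType F) (P : naIdeal A -> Prop).

(** Encoded as an intersection of subspaces, which avoids finite sums and yields induction by
    [ideal_sum_sub]. *)
Definition ideal_sum (x : A) : bool :=
  `[< forall N : {pred A}, submod_closed N ->
      (forall I, P I -> {subset I <= N}) -> x \in N >].

Lemma ideal_sum_sub (N : {pred A}) : submod_closed N ->
  (forall I, P I -> {subset I <= N}) -> {subset ideal_sum <= N}.
Proof. by move=> Nlin PN x /asboolP; apply. Qed.

Lemma sub_ideal_sum I : P I -> {subset I <= ideal_sum}.
Proof. by move=> PI x Ix; apply/asboolP => N _ PN; apply: PN Ix. Qed.

Fact ideal_sum_submod : submod_closed ideal_sum.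
Proof.
split=> [|c x y /asboolP Sx /asboolP Sy]; apply/asboolP => N Nlin PN.
  exact: Nlin.1.
by apply: Nlin.2; [apply: Sx | apply: Sy].
Qed.

HB.instance Definition _ :=
  GRing.isSubmodClosed.Build F A ideal_sum ideal_sum_submod.

Fact ideal_sum_l x y : x \in ideal_sum -> x ** y \in ideal_sum.
Proof.
pose N : {pred A} := [pred z | z ** y \in ideal_sum].
move: x; apply: (@ideal_sum_sub N) => [|I PI x Ix].
  split=> [|c u v]; rewrite !inE.
    by rewrite -[0 ** y]/(rmul y 0) linear0 rpred0.
  by move=> uS vS; rewrite namul_linear_l rpredD // rpredZ.
by rewrite inE; apply: (sub_ideal_sum PI); apply: twoSided_l.
Qed.

Fact ideal_sum_r x y : y \in ideal_sum -> x ** y \in ideal_sum.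
Proof.
pose N : {pred A} := [pred z | x ** z \in ideal_sum].
move: y; apply: (@ideal_sum_sub N) => [|I PI y Iy].
  split=> [|c u v]; rewrite !inE.
    by rewrite -[x ** 0]/(rmul 0 x) linear0 rpred0.
  by move=> uS vS; rewrite namul_linear_r rpredD // rpredZ.
by rewrite inE; apply: (sub_ideal_sum PI); apply: twoSided_r.
Qed.

HB.instance Definition _ :=
  isTwoSided.Build F A ideal_sum ideal_sum_l ideal_sum_r.

End IdealSum.

(** * Inclusion of one ideal in another *)

Section IdealInclusion.
Variables (F : fieldType) (A : naAlgType F) (I J : naIdeal A).
Hypothesis IJ : {subset I <= J}.

Definition ideal_incl (x : idealAlg I) : idealAlg J := IdealAlg (IJ (valP x)).

Fact ideal_incl_linear : linear ideal_incl.
Proof. by move=> c x y; apply: val_inj. Qed.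
HB.instance Definition _ :=
  GRing.isLinear.Build F (idealAlg I) (idealAlg J) _ ideal_incl
    ideal_incl_linear.

Lemma ideal_inclM : namul_morphism ideal_incl.
Proof. by move=> x y; apply: val_inj. Qed.

Lemma ideal_incl_ideal b a :
  (exists b', ideal_incl b' = ideal_incl b ** a) /\
  (exists b', ideal_incl b' = a ** ideal_incl b).
Proof.
split.
  have Iba : val b ** val a \in I by apply: twoSided_l; apply: valP.
  by exists (IdealAlg Iba); apply: val_inj.
have Iab : val a ** val b \in I by apply: twoSided_r; apply: valP.
by exists (IdealAlg Iab); apply: val_inj.
Qed.

End IdealInclusion.

(** * Preimages of ideals of a quotient *)

Section QuotientPreimage.
Variables (F : fieldType) (A : naAlgType F) (I : naIdeal A).
Variable J : naIdeal (quotAlg I).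

Definition preim_pred (x : A) : bool := quot_pi I x \in J.

Lemma in_preim_pred x : (x \in preim_pred) = (quot_pi I x \in J).
Proof. by []. Qed.

Fact preim_submod : submod_closed preim_pred.
Proof.
split=> [|c x y]; first by rewrite in_preim_pred linear0 rpred0.
rewrite !in_preim_pred => xJ yJ.
by rewrite linearP rpredD // rpredZ.
Qed.
HB.instance Definition _ :=
  GRing.isSubmodClosed.Build F A preim_pred preim_submod.

Fact preim_l x y : x \in preim_pred -> x ** y \in preim_pred.
Proof.
by rewrite !in_preim_pred quot_piM; apply: twoSided_l.
Qed.
Fact preim_r x y : y \in preim_pred -> x ** y \in preim_pred.
Proof.
by rewrite !in_preim_pred quot_piM; apply: twoSided_r.
Qed.
HB.instance Definition _ :=
  isTwoSided.Build F A preim_pred preim_l preim_r.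

Definition quot_preim : naIdeal A := NaIdeal.clone F A preim_pred _.

Lemma in_quot_preim x : (x \in quot_preim) = (quot_pi I x \in J).
Proof. by []. Qed.

Lemma sub_quot_preim : {subset I <= quot_preim}.
Proof.
move=> x Ix; rewrite in_quot_preim.
suff -> : quot_pi I x = 0 by rewrite rpred0.
by rewrite -(linear0 (quot_pi I)); apply/quot_piP; rewrite subr0.
Qed.

Definition preim_pi (x : idealAlg quot_preim) : idealAlg J :=
  @IdealAlg F (quotAlg I) J (quot_pi I (val x)) (valP x).

Fact preim_pi_linear : linear preim_pi.
Proof. by move=> c x y; apply: val_inj; rewrite /= !linearP. Qed.
HB.instance Definition _ :=
  GRing.isLinear.Build F (idealAlg quot_preim) (idealAlg J) _ preim_pi
    preim_pi_linear.

Lemma preim_piM : namul_morphism preim_pi.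
Proof. by move=> x y; apply: val_inj; rewrite /= quot_piM. Qed.

Lemma preim_pi_surj y : exists x, preim_pi x = y.
Proof.
have yJ : quot_repr (val y) \in quot_preim.
  by rewrite in_quot_preim quot_reprK; apply: valP.
by exists (IdealAlg yJ); apply: val_inj; rewrite /= quot_reprK.
Qed.

Lemma preim_pi_eq0 x : preim_pi x = 0 -> val x \in I.
Proof.
move/(congr1 val) => /=; rewrite -[RHS]/(0 : quotAlg I).
by rewrite -(linear0 (quot_pi I)) => /quot_piP; rewrite subr0.
Qed.

End QuotientPreimage.

(** * Radical properties of the class *)

Lemma ideal_rep0 (F : fieldType) (A : novikovType F) (I J : naIdeal A)
    (IJ : {subset I <= J}) (M : lmodType F)
    (rho : {linear idealAlg J -> rEnd M}) :
  irreducible_module rho -> class_ideal (@no_irreducible_modules F) I ->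
  forall x, rho (ideal_incl IJ x) = 0.
Proof.
(* A nonzero action would restrict to an irreducible module of [I]. *)
move=> irr RI x; apply: contrapT => nz; apply: RI.
exists M, (rho \o ideal_incl IJ); apply: irreducible_comp => //.
- exact: ideal_inclM.
- exact: ideal_incl_ideal.
- apply: contrapT => all0; apply: nz; apply: rEndP => m.
  by apply: contrapT => /eqP nz; apply: all0; exists m, x.
Qed.

(** Closure under extensions: [I] annihilates any irreducible module of the preimage, which thus
    descends to [J]. *)
Lemma quot_preim_class (F : fieldType) (A : novikovType F) (I : naIdeal A)
    (J : naIdeal (quotAlg I)) :
  class_ideal (@no_irreducible_modules F) I ->
  class_ideal (@no_irreducible_modules F) J ->
  class_ideal (@no_irreducible_modules F) (quot_preim J).
Proof.
move=> RI RJ [M [rho irr]]; apply: RJ; exists M.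
have ker x : preim_pi x = 0 -> rho x = 0.
  move/preim_pi_eq0 => Ix.
  have <- := ideal_rep0 (@sub_quot_preim F A I J) irr RI (IdealAlg Ix).
  by congr (rho _); apply: val_inj.
exact: irreducible_factor (@preim_piM _ _ _ J) (@preim_pi_surj _ _ _ J) ker irr.
Qed.

Theorem theorem4p2 (F : fieldType) (charF : 2%N \notin [pchar F]) :
  radical_class (@no_irreducible_modules F).
Proof.
split.
- move=> A B f fM fsurj noA [M [rho irr]]; apply: noA.
  (* The image of the surjection [f] is trivially an ideal. *)
  exists M, (rho \o f); apply: irreducible_comp => //.
  have [_ _ [m [b mb]]] := irr.
  by have [a fa] := fsurj b; exists m, a; rewrite fa.
- move=> A.
  pose S := NaIdeal.clone F A
    (ideal_sum (class_ideal (A := A) (@no_irreducible_modules F))) _.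
  exists S; split; last by move=> J; apply: sub_ideal_sum.
  move=> [M [rho irr]]; have [_ _ [m [a ma]]] := irr.
  (* The kernel of [rho], viewed inside [A] so that [ideal_sum_sub] applies. *)
  pose N : {pred A} :=
    [pred x | `[< exists Sx : x \in S, rho (IdealAlg Sx) = 0 >]].
  have SN : {subset S <= N}.
    apply: ideal_sum_sub => [|I RI x Ix].
      split.
        apply/asboolP; exists (rpred0 S); rewrite -[RHS](linear0 rho).
        by congr (rho _); apply: val_inj.
      move=> c x y /asboolP[Sx x0] /asboolP[Sy y0]; apply/asboolP.
      have Sz : c *: x + y \in S by rewrite rpredD // rpredZ.
      exists Sz; have -> : IdealAlg Sz = c *: IdealAlg Sx + IdealAlg Sy.
        exact: val_inj.
      by rewrite linearP /= x0 y0 scaler0 addr0.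
    have IS := sub_ideal_sum RI; apply/asboolP; exists (IS x Ix).
    have <- := ideal_rep0 IS irr RI (IdealAlg Ix).
    by congr (rho _); apply: val_inj.
  have /asboolP[Sa a0] := SN _ (valP a); move: ma.
  have -> : a = IdealAlg Sa by apply: val_inj.
  by rewrite a0 eqxx.
- move=> A I [RI Imax] J RJ y; rewrite inE.
  apply/idP/eqP => [yJ|->]; last exact: rpred0.
  rewrite -(quot_reprK y) -(linear0 (quot_pi I)); apply/quot_piP.
  (* The preimage of [J] belongs to the class, hence lies in [I]. *)
  rewrite subr0; apply: Imax (quot_preim_class RI RJ) _ _.
  by rewrite in_quot_preim quot_reprK.
Qed.
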